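(* For all $m,n\in\mathbb{Z}_{\ge0}$, we have \[ \sum_{\substack{m_0+m_1+\cdots+m_{2n}=m\\ m_0,\ldots,m_{2n}\ge 0}} \zeta^{\star}(\{2\}^{m_0},3,\{2\}^{m_1},1,\{2\}^{m_2},\ldots,3,\{2\}^{m_{2n-1}},1,\{2\}^{m_{2n}}) \in\mathbb{Q}\,\pi^{2m+4n}, \] where the sum runs over all $(2n+1)$-tuples of nonnegative integers $(m_0,\ldots,m_{2n})$ with sum $m$.
   Context: For integers $k_1,\ldots,k_n\ge1$ with $k_1\ge2$, the multiple zeta-star value is \[ \zeta^{\star}(k_1,\ldots,k_n)=\sum_{m_1\ge\cdots\ge m_n>0}\frac{1}{m_1^{k_1}\cdots m_n^{k_n}}. \] By convention, the value of $\zeta^\star$ at the empty sequence is $1$. The notation $\{2\}^{r}$ means the sequence $2,\ldots,2$ with $r$ entries (empty if $r=0$). The argument in the sum is the sequence obtained from $3,1,3,1,\ldots,3,1$ ($n$ copies of $3,1$, of length $2n$) by inserting $m_0$ twos before the first entry, $m_i$ twos between the $i$-th and $(i+1)$-th entries, and $m_{2n}$ twos after the last entry; for $n=0$ it is $\{2\}^{m_0}$. $\mathbb{Q}\pi^{k}$ denotes the set of rational multiples of $\pi^k$. *)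

(* Defs.v *)
From mathcomp Require Import all_boot all_order all_algebra.
From mathcomp Require Import all_classical all_reals all_analysis.

Set Implicit Arguments.
Unset Strict Implicit.
Unset Printing Implicit Defensive.

Import Order.TTheory GRing.Theory Num.Theory.

Local Open Scope classical_set_scope.
Local Open Scope ring_scope.

(* The sum of a family of nonnegative terms, hence taken in the extended reals:
   a divergent value is +oo. For k = [::] the only index is [::], and its term
   is the empty product 1. *)
Definition zeta_star (R : realType) (k : seq nat) : \bar R :=
  \esum_(m in [set m : seq nat |
               [/\ size m = size k, sorted geq m & all (ltn 0%N) m]])
    (\prod_(p <- zip m k) (p.1%:R ^+ p.2)^-1)%:E.

(* {2}^(a_0), 3, {2}^(a_1), 1, {2}^(a_2), ..., 3, {2}^(a_(2n-1)), 1, {2}^(a_2n):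
   the i-th entry of 3, 1, ..., 3, 1, counted from 0, is 3 iff i is even, and is
   followed by a_(i+1) = a (lift ord0 i) twos. *)
Definition twos_in_31 (n : nat) (a : 'I_(2 * n).+1 -> nat) : seq nat :=
  nseq (a ord0) 2%N ++
  flatten [seq (if odd i then 1 else 3)%N :: nseq (a (lift ord0 i)) 2%N
          | i : 'I_(2 * n)].

(* Main.v *)
(* For a word alternating 3 and 1 with twos inserted, truncate the sums at N and
   collect them in a generating series in h, marking each 2 by xi h and each
   pair 3, 1 by om h^2.  Reading the integers k from N down to 1, repetitions
   being allowed, multiplies 2 x 2 matrices (1 - M_k)^-1; pulling out the
   determinants leaves the adjugates, whose product is the generating series of
   the corresponding sums over strictly decreasing indices (with -xi for xi), to
   which the shuffle argument of Bowman and Bradley applies.  With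
   xi = - (x + y) and om = 4 x y this gives, at every finite level,

     S_N(h) Z_N(a h) Z_N(b h) = sum over i + j <= N of f_i(x h) f_j(y h),

   where Z_N(c) = prod_(k <= N) (1 + c / k^2), the f_i(c) are the increments of
   Z_i(c), a + b = 2 (x + y) and a b = (x - y)^2.  The right-hand side tends to
   Z(x h) Z(y h), and the coefficient of c^r in Z(c) is pi^(2 r) / (2 r + 1)!.
   If x, y, a, b are rational, division of power series shows that the
   coefficients of S(h) are rational multiples of powers of pi; varying om and
   interpolating (Vandermonde) isolates the individual sums. *)

Require Import Defs.
From HB Require Import structures.
From mathcomp Require Import all_boot all_order all_algebra.
From mathcomp Require Import all_classical all_reals all_analysis.
From mathcomp Require Import ring lra zify.

Set Implicit Arguments.
Unset Strict Implicit.
Unset Printing Implicit Defensive.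

Import Order.TTheory GRing.Theory Num.Theory.
Import numFieldNormedType.Exports.

Local Open Scope classical_set_scope.
Local Open Scope ring_scope.

(* The alias hides the pointwise ring structure of [nat -> K]. *)
Definition pser (K : comNzRingType) := nat -> K.

(** * The ring of formal power series *)

Section PowerSeries.
Variable K : comNzRingType.
Implicit Types f g h : pser K.

HB.instance Definition _ := GRing.Zmodule.copy (pser K) (nat -> K).

Definition pser_one : pser K := fun n => (n == 0%N)%:R.
Definition pser_mul f g : pser K := fun n => \sum_(i < n.+1) f i * g (n - i)%N.

(** The coefficients of a product up to index n depend only on the truncations at n, so series
    inherit associativity and commutativity from polynomials. *)
Definition ptrunc n f : {poly K} := \poly_(i < n.+1) f i.

Lemma coef_ptrunc n f i : (i <= n)%N -> (ptrunc n f)`_i = f i.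
Proof. by move=> le_in; rewrite coef_poly ltnS le_in. Qed.

Lemma coef_ptruncM n f g i : (i <= n)%N ->
  (ptrunc n f * ptrunc n g)`_i = pser_mul f g i.
Proof.
move=> le_in; rewrite coefM; apply: eq_bigr => j _.
have le_jn := leq_trans (ltn_ord j : (j <= i)%N) le_in.
by rewrite !coef_ptrunc // (leq_trans (leq_subr _ _)).
Qed.

Lemma pser_mulA : associative pser_mul.
Proof.
move=> f g h; apply/funext => n.
transitivity ((ptrunc n f * (ptrunc n g * ptrunc n h))`_n).
  rewrite coefM; apply: eq_bigr => j _.
  by rewrite coef_ptrunc ?coef_ptruncM ?leq_subr // -ltnS.
rewrite mulrA coefM; apply: eq_bigr => j _.
by rewrite coef_ptruncM ?coef_ptrunc ?leq_subr // -ltnS.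
Qed.

Lemma pser_mulC : commutative pser_mul.
Proof.
by move=> f g; apply/funext => n; rewrite -!(@coef_ptruncM n) // mulrC.
Qed.

Lemma pser_mul1 : left_id pser_one pser_mul.
Proof.
move=> f; apply/funext => n.
rewrite /pser_mul big_ord_recl /pser_one /= mul1r subn0 big1 ?addr0 // => i _.
by rewrite /= mul0r.
Qed.

Lemma pser_mulDl : left_distributive pser_mul +%R.
Proof.
move=> f g h; apply/funext => n; rewrite /pser_mul.
transitivity (\sum_(i < n.+1) (f i * h (n - i)%N + g i * h (n - i)%N)).
  by apply: eq_bigr => i _; rewrite -mulrDl.
by rewrite big_split.
Qed.

Lemma pser_one_neq0 : pser_one != 0.
Proof.
apply/eqP => /(congr1 (fun f => f 0%N)) /eqP.
by rewrite /pser_one /= (oner_eq0 K).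
Qed.

HB.instance Definition _ := GRing.Zmodule_isComNzRing.Build (pser K)
  pser_mulA pser_mulC pser_mul1 pser_mulDl pser_one_neq0.

Lemma pserME f g n : (f * g) n = \sum_(i < n.+1) f i * g (n - i)%N.
Proof. by []. Qed.

Lemma pserDE f g n : (f + g) n = f n + g n.
Proof. by []. Qed.

Lemma pser_sumE I (r : seq I) (P : pred I) (F : I -> pser K) n :
  (\sum_(i <- r | P i) F i) n = \sum_(i <- r | P i) F i n.
Proof. by elim/big_rec2: _ => // i x y _ <-. Qed.

Lemma pser1E n : (1 : pser K) n = (n == 0%N)%:R.
Proof. by []. Qed.

Definition monom (c : K) d : pser K := fun n => if n == d then c else 0.

Lemma monomM c d f n :
  (monom c d * f) n = if (d <= n)%N then c * f (n - d)%N else 0.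
Proof.
rewrite pserME /monom; case: leqP => [le_dn|lt_nd].
  rewrite (bigD1 (Ordinal (le_dn : (d < n.+1)%N))) //= eqxx big1 ?addr0 // => i.
  by rewrite -val_eqE /= => /negPf ->; rewrite mul0r.
rewrite big1 // => i _; rewrite ltn_eqF ?mul0r //.
exact: leq_ltn_trans (ltn_ord i : (i <= n)%N) lt_nd.
Qed.

Lemma monomMM c d c' d' : monom c d * monom c' d' = monom (c * c') (d + d').
Proof.
apply/funext => n; rewrite monomM /monom; case: leqP => [le_dn|lt_nd].
  by rewrite -(eqn_add2l d) subnKC //; case: eqP; rewrite ?mulr0.
by rewrite ltn_eqF // ltn_addr.
Qed.

Lemma monomD c c' d : monom c d + monom c' d = monom (c + c') d.
Proof. by apply/funext => n; rewrite pserDE /monom; case: eqP; rewrite ?addr0. Qed.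

Lemma monom1 : monom 1 0 = 1.
Proof. by apply/funext => n; rewrite /monom pser1E; case: eqP. Qed.

Lemma monom_nat (m : nat) : monom m%:R 0 = m%:R.
Proof.
elim: m => [|m IH]; first by apply/funext => n; rewrite /monom; case: eqP.
by rewrite -addn1 !natrD -monomD IH monom1.
Qed.

End PowerSeries.

(** * Strict and star sums over alternating words, at a finite level *)

Section Shuffle.
Variables (K : comNzRingType) (iv : nat -> K).
Hypothesis ivK : forall n, iv n.+1 * n.+1%:R = 1.

(** [iv k] stands for 1/k. In the application K is itself a ring of series in h and X a multiple of
    h; [pser K] then brings in a second variable t. *)
Definition zprod (X : K) n := \prod_(k < n) (1 + X * iv k.+1 ^+ 2).

(** For X = - a^2 these are the coefficients of the hypergeometric series F(a, -a; 1; t). *)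
Definition zterm (X : K) : pser K :=
  fun n => if n is m.+1 then X * iv n ^+ 2 * zprod X m else 1.

Lemma sum_zterm X n : \sum_(k < n.+1) zterm X k = zprod X n.
Proof.
elim: n => [|n IH]; first by rewrite big_ord_recr /= /zprod !big_ord0 add0r.
by rewrite big_ord_recr IH /= /zprod big_ord_recr /=; ring.
Qed.

(** The Euler operator t d/dt. *)
Definition tderiv (f : pser K) : pser K := fun n => n%:R * f n.

(** The series t / (1 - t); multiplying by it takes strict partial sums. *)
Definition tsum : pser K := fun n => (0 < n)%N%:R.

Lemma tsumM f n : (tsum * f) n = \sum_(k < n) f k.
Proof.
rewrite mulrC pserME big_ord_recr /= subnn mulr0 addr0.
by apply: eq_bigr => i _; rewrite /tsum subn_gt0 ltn_ord mulr1.
Qed.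

Lemma tderivM f g : tderiv (f * g) = tderiv f * g + f * tderiv g.
Proof.
apply/funext => n; rewrite pserDE /tderiv !pserME mulr_sumr -big_split /=.
apply: eq_bigr => i _.
have -> : n%:R = i%:R + (n - i)%:R :> K.
  by rewrite -natrD subnKC // -ltnS.
by ring.
Qed.

(** The hypergeometric equation: once n^2 cancels, both coefficients of t^n, n > 0, are X times
    [zprod X] at n - 1. *)
Lemma tderiv2_zterm X :
  tderiv (tderiv (zterm X)) = monom X 0 * (tsum * zterm X).
Proof.
apply/funext => -[|n]; rewrite monomM /= tsumM /tderiv.
  by rewrite big_ord0 mul0r mulr0.
rewrite sum_zterm /=.
transitivity ((iv n.+1 * n.+1%:R) ^+ 2 * (X * zprod X n)); first by ring.
by rewrite ivK expr1n mul1r.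
Qed.

(* Partial sums, up to index n, of the strict multiple sums over the words from
   the letters 2, 3, 1 (weights X + Y, 2, 2 X Y) in which 3 and 1 alternate: the
   first component for words from 3 to 1, the second one, divided by 2 X Y, for
   words from 1 to 1. *)
Fixpoint bbpair (X Y : K) n : K * K :=
  if n is m.+1 then
    let: (u, v) := bbpair X Y m in
    ((1 + (X + Y) * iv n ^+ 2) * u + 4 * X * Y * iv n ^+ 3 * v,
     (1 + (X + Y) * iv n ^+ 2) * v + iv n * u)
  else (1, 0).

(* The series f = sum_n zterm X n t^n solves (1 - t) D (t D f) = X f.  For the
   solutions f and g attached to X and Y, the products f g, (t D f) g, f (t D g)
   and (t D f) (t D g) form a first-order system, whose coefficients obey the
   recursion of bbpair. *)
Lemma bbpair_shuffle X Y n :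
  (bbpair X Y n).1 = \sum_(k < n.+1) (zterm X * zterm Y) k.
Proof.
set f := zterm X; set g := zterm Y.
set f1 := tderiv f; set g1 := tderiv g.
set c := monom X 0 * (f * g1) + monom Y 0 * (f1 * g).
have d2f : tderiv f1 = monom X 0 * (tsum * f) by exact: tderiv2_zterm.
have d2g : tderiv g1 = monom Y 0 * (tsum * g) by exact: tderiv2_zterm.
have dp : tderiv (f * g) = f1 * g + f * g1 by rewrite tderivM.
have da : tderiv (f1 * g) = monom X 0 * (tsum * (f * g)) + f1 * g1.
  by rewrite tderivM d2f -/g1; ring.
have db : tderiv (f * g1) = monom Y 0 * (tsum * (f * g)) + f1 * g1.
  by rewrite tderivM d2g -/f1; ring.
have dr : tderiv (f1 * g1) = tsum * c.
  by rewrite tderivM d2f d2g /c; ring.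
have int (h k : pser K) m : tderiv h = k -> h m.+1 = iv m.+1 * k m.+1.
  by move=> <-; rewrite /tderiv mulrA ivK mul1r.
have cE m : c m = X * (f * g1) m + Y * (f1 * g) m.
  by rewrite /c pserDE !monomM subn0.
(* The factor 2 X Y stays on the left, since K need not allow division by it. *)
suff [] : (bbpair X Y n).1 = \sum_(k < n.+1) (f * g) k /\
  2 * X * Y * (bbpair X Y n).2 = \sum_(k < n.+1) c k by [].
elim: n => [|n [IHu IHv]].
  rewrite /= !big_ord_recr !big_ord0 /= !add0r cE !pserME !big_ord_recr !big_ord0.
  by rewrite /= subnn /f1 /g1 /tderiv /=; split; ring.
(* Division by n + 1 turns the differential system into formulas for the coefficients of index n + 1
   in terms of the two partial sums up to n. *)
have rE := int _ _ n dr; rewrite tsumM -IHv in rE.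
have aE := int _ _ n da; rewrite pserDE monomM /= subn0 tsumM -IHu rE in aE.
have bE := int _ _ n db; rewrite pserDE monomM /= subn0 tsumM -IHu rE in bE.
have pE := int _ _ n dp; rewrite pserDE aE bE in pE.
have sumS (h : nat -> K) :
  \sum_(k < n.+2) h k = \sum_(k < n.+1) h k + h n.+1 by rewrite big_ord_recr.
rewrite !sumS -IHu -IHv cE aE bE pE /=.
by case: (bbpair X Y n) => u v /=; split; ring.
Qed.

(* Solving the recursion for (SA n.+1, SB n.+1) produces the determinant
   (1 + (X + Y) / k^2)^2 - 4 X Y / k^4 = (1 + A / k^2) (1 + B / k^2). *)
Lemma star_shuffle (X Y A B : K) (SA SB : nat -> K) :
    A + B = 2 * (X + Y) -> A * B = (X - Y) ^+ 2 ->
    SA 0%N = 1 -> SB 0%N = 0 ->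
    (forall n, SA n.+1 = SA n - (X + Y) * iv n.+1 ^+ 2 * SA n.+1
                       + 4 * X * Y * iv n.+1 ^+ 3 * SB n.+1) ->
    (forall n, SB n.+1 = SB n - (X + Y) * iv n.+1 ^+ 2 * SB n.+1
                       + iv n.+1 * SA n.+1) ->
  forall n, SA n * (zprod A n * zprod B n) =
            \sum_(k < n.+1) (zterm X * zterm Y) k.
Proof.
move=> sAB pAB SA0 SB0 SAS SBS n; rewrite -bbpair_shuffle.
suff [] : SA n * (zprod A n * zprod B n) = (bbpair X Y n).1 /\
  SB n * (zprod A n * zprod B n) = (bbpair X Y n).2 by [].
elim: n => [|n [IHu IHv]].
  by rewrite /zprod !big_ord0 SA0 SB0 !mulr1.
have -> : zprod A n.+1 * zprod B n.+1 = zprod A n * zprod B n *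
    ((1 + (X + Y) * iv n.+1 ^+ 2) ^+ 2 - 4 * X * Y * iv n.+1 ^+ 4).
  rewrite /zprod !big_ord_recr /=.
  set i := iv _; set a := \prod_(_ < n) _; set b := \prod_(_ < n) _.
  have -> : a * (1 + A * i ^+ 2) * (b * (1 + B * i ^+ 2)) =
    a * b * (1 + (A + B) * i ^+ 2 + (A * B) * i ^+ 4) by ring.
  by rewrite sAB pAB; ring.
rewrite /=; case: (bbpair X Y n) IHu IHv => u v /= <- <-.
(* The level n vector is a matrix applied to the level n + 1 vector. The recursion of [bbpair]
   applies the adjugate of this matrix, so only the determinant survives. *)
move: (SAS n) (SBS n) => eA eB.
have {}eA : SA n = (1 + (X + Y) * iv n.+1 ^+ 2) * SA n.+1
  - 4 * X * Y * iv n.+1 ^+ 3 * SB n.+1.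
  apply/esym/eqP; rewrite -subr_eq0 -(subrr (SA n.+1)) [in X in _ == _ - X]eA.
  by apply/eqP; ring.
have {}eB : SB n = (1 + (X + Y) * iv n.+1 ^+ 2) * SB n.+1
  - iv n.+1 * SA n.+1.
  apply/esym/eqP; rewrite -subr_eq0 -(subrr (SB n.+1)) [in X in _ == _ - X]eB.
  by apply/eqP; ring.
by rewrite eA eB; split; ring.
Qed.

End Shuffle.

(** * Words with inserted twos *)

Section Words.
Variable R : realType.
Implicit Types (g : seq nat -> R) (cs w : seq nat).

(** The largest index is at most N. The inner bound is the index [j.+1] just chosen, so repetitions
    are allowed. *)
Fixpoint zstar_trunc N (k : seq nat) : R :=
  if k is k0 :: k' then \sum_(j < N) (j.+1%:R ^+ k0)^-1 * zstar_trunc j.+1 k'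
  else 1.

Lemma zstar_truncS N k0 k : zstar_trunc N.+1 (k0 :: k) =
  zstar_trunc N (k0 :: k) + (N.+1%:R ^+ k0)^-1 * zstar_trunc N.+1 k.
Proof. by rewrite /= big_ord_recr. Qed.

(** A recursion over all ways to distribute m twos around the letters of [cs]; g is arbitrary so
    that it can absorb the prefix already built. *)
Fixpoint twos_sum cs m g : R :=
  if cs is c :: cs' then
    \sum_(j < m.+1) twos_sum cs' (m - j)%N (fun w => g (nseq j 2%N ++ c :: w))
  else g (nseq m 2%N).

Lemma eq_twos_sum cs m g g' : g =1 g' -> twos_sum cs m g = twos_sum cs m g'.
Proof. by move=> /funext ->. Qed.

Lemma twos_sum_lin cs m g g' a :
  twos_sum cs m (fun w => g w + a * g' w) = twos_sum cs m g + a * twos_sum cs m g'.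
Proof.
elim: cs m g g' => [//|c cs IH] m g g' /=.
rewrite mulr_sumr -big_split /=; apply: eq_bigr => j _.
by rewrite -IH.
Qed.

Lemma twos_sum0 cs m : twos_sum cs m (fun=> 0) = 0.
Proof. by elim: cs m => [//|c cs IH] m /=; rewrite big1. Qed.

(** The words are split by their first letter, which is an inserted two or the head of [cs]. *)
Lemma twos_sum_cons cs m g :
  twos_sum cs m g =
    (if m is m'.+1 then twos_sum cs m' (fun w => g (2%N :: w)) else 0) +
    (if cs is c :: cs' then twos_sum cs' m (fun w => g (c :: w))
     else if m is 0%N then g [::] else 0).
Proof.
case: cs => [|c cs]; first by case: m => [|m] /=; rewrite ?add0r ?addr0.
case: m => [|m] /=; first by rewrite big_ord1 add0r.
by rewrite big_ord_recl subn0 addrC.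
Qed.

Lemma twos_sum_zstar_trunc0 cs m :
  twos_sum cs m (zstar_trunc 0) = ((cs == [::]) && (m == 0%N))%:R.
Proof.
case: cs => [|c cs] /=; first by case: m => [|m] //=; rewrite big_ord0.
rewrite big1 // => j _; rewrite -[RHS](twos_sum0 cs (m - j)%N).
by apply: eq_twos_sum => w; case: (val j) => [|i] /=; rewrite big_ord0.
Qed.

(** Either the largest index is at most N, or it equals N + 1 and the first letter is removed; the
    level then stays N + 1 because indices may repeat. *)
Lemma twos_sum_zstar_truncS N cs m :
  twos_sum cs m (zstar_trunc N.+1) = twos_sum cs m (zstar_trunc N)
  + (N.+1%:R ^+ 2)^-1 *
    (if m is m'.+1 then twos_sum cs m' (zstar_trunc N.+1) else 0)
  + (if cs is c :: cs' then
       (N.+1%:R ^+ c)^-1 * twos_sum cs' m (zstar_trunc N.+1) else 0).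
Proof.
have consE c cs' m' :
  twos_sum cs' m' (fun w => zstar_trunc N.+1 (c :: w)) =
  twos_sum cs' m' (fun w => zstar_trunc N (c :: w)) +
  (N.+1%:R ^+ c)^-1 * twos_sum cs' m' (zstar_trunc N.+1).
  by rewrite -twos_sum_lin; apply: eq_twos_sum => w; rewrite zstar_truncS.
rewrite 2!(twos_sum_cons cs m).
by case: cs m => [|c cs] [|m]; rewrite ?consE; ring.
Qed.

(** The letters are arbitrary because removing the first one shifts the alternation of 3 and 1. *)
Definition interleave_twos L (c : nat -> nat) (a : 'I_L.+1 -> nat) : seq nat :=
  nseq (a ord0) 2%N ++
  flatten [seq c i :: nseq (a (lift ord0 i)) 2%N | i : 'I_L].

Lemma interleave_twosS L c (a : 'I_L.+2 -> nat) :
  interleave_twos c a = nseq (a ord0) 2%N ++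
    c 0%N :: interleave_twos (c \o S) (fun i => a (lift ord0 i)).
Proof.
rewrite /interleave_twos; congr (_ ++ _).
by rewrite /image_mem enum_ordSl /= -map_comp.
Qed.

(** M is independent of m: removing the first block of twos lowers the total but not the type of the
    entries. *)
Lemma sum_interleave_twos L c M m g : (m <= M)%N ->
  \sum_(a : {ffun 'I_L.+1 -> 'I_M.+1} | (\sum_i (a i : nat))%N == m)
     g (interleave_twos c (fun i => a i : nat)) = twos_sum (mkseq c L) m g.
Proof.
elim: L c m g => [|L IH] c m g le_mM.
  rewrite (big_pred1 [ffun=> inord m]) => [|a]; last first.
    rewrite /= big_ord1; apply/eqP/eqP => [am|->]; last first.
      by rewrite ffunE inordK.
    by apply/ffunP => i; rewrite ffunE; apply/val_inj; rewrite /= ord1 inordK.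
  rewrite /interleave_twos /image_mem (size0nil (size_enum_ord 0)) cats0.
  by rewrite ffunE inordK.
pose h (p : 'I_M.+1 * {ffun 'I_L.+1 -> 'I_M.+1}) :=
  [ffun i => oapp p.2 p.1 (unlift ord0 i)].
pose h' (a : {ffun 'I_L.+2 -> 'I_M.+1}) := (a ord0, [ffun i => a (lift ord0 i)]).
have h0 p : h p ord0 = p.1 by rewrite ffunE unlift_none.
have hl p i : h p (lift ord0 i) = p.2 i by rewrite ffunE liftK.
rewrite (reindex h) /=; last first.
  exists h' => [[j b]|a] _; rewrite /h'.
    by rewrite h0; congr pair; apply/ffunP => i; rewrite ffunE hl.
  by apply/ffunP => i; rewrite ffunE; case: unliftP => [k|] -> //=; rewrite ffunE.
transitivity (\sum_(p : 'I_M.+1 * {ffun 'I_L.+1 -> 'I_M.+1} |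
    (p.1 + \sum_i (p.2 i : nat))%N == m)
  g (nseq p.1 2%N ++ c 0%N :: interleave_twos (c \o S) (fun i => p.2 i : nat))).
  apply: eq_big => [p|p _].
    rewrite big_ord_recl h0; congr (_ + _ == m)%N.
    by apply: eq_bigr => i _; rewrite hl.
  rewrite interleave_twosS h0; do 4![congr (_ _)].
  by apply/funext => i; rewrite hl.
rewrite -(pair_big_dep xpredT
  (fun (j : 'I_M.+1) (b : {ffun 'I_L.+1 -> 'I_M.+1}) => (j + \sum_i (b i : nat))%N == m)
  (fun (j : 'I_M.+1) (b : {ffun 'I_L.+1 -> 'I_M.+1}) => g (nseq j 2%N ++ c 0%N ::
    interleave_twos (c \o S) (fun i => b i : nat)))) /=.
(* A first block longer than m leaves no admissible tail. *)
rewrite (bigID (fun j : 'I_M.+1 => (j <= m)%N)) /= [X in _ + X]big1 ?addr0; last first.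
  move=> j; rewrite -ltnNge => lt_mj; rewrite big_pred0 // => b.
  by apply/negbTE; rewrite neq_ltn (leq_trans lt_mj) ?leq_addr ?orbT.
have -> : [seq c i | i <- iota 1 L] = mkseq (c \o S) L.
  by rewrite (iotaDl 1 0) -map_comp.
rewrite (big_ord_widen _ (fun j : nat => twos_sum (mkseq (c \o S) L) (m - j)%N
  (fun w => g (nseq j 2%N ++ c 0%N :: w))) (le_mM : (m.+1 <= M.+1)%N)).
apply: eq_big => [j|j le_jm]; first by rewrite ltnS.
rewrite -(IH (c \o S)) ?(leq_trans (leq_subr _ _)) //.
by apply: eq_bigl => b; rewrite -[RHS](eqn_add2l j) subnKC.
Qed.

End Words.

(** * Convergence of the truncated sums *)

Section Truncation.
Variable R : realType.

Lemma zstar_trunc_ge0 N (k : seq nat) : 0 <= zstar_trunc R N k.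
Proof.
elim: k N => [|k0 k IH] N /=; first exact: ler01.
by apply: sumr_ge0 => j _; rewrite mulr_ge0 // invr_ge0 exprn_ge0.
Qed.

Lemma zstar_trunc_nd (k : seq nat) :
  {homo (fun N => (zstar_trunc R N k)%:E) : m n / (m <= n)%N >-> (m <= n)%E}.
Proof.
apply: homo_leq => [x|y x z|N]; [exact: lexx|exact: le_trans|].
case: k => [|k0 k]; rewrite lee_fin ?zstar_truncS //= lerDl.
by rewrite mulr_ge0 ?zstar_trunc_ge0 // invr_ge0 exprn_ge0.
Qed.

Fixpoint star_index N (k : seq nat) : seq (seq nat) :=
  if k is k0 :: k' then [seq j :: t | j <- iota 1 N, t <- star_index j k']
  else [:: [::]].

Lemma mem_star_index N (k m : seq nat) :
  (m \in star_index N k) =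
  [&& size m == size k, sorted geq m, all (ltn 0%N) m & all (geq N) m].
Proof.
elim: k N m => [|k0 k IH] N m; first by case: m.
apply/allpairsPdep/idP => [[j [t]]|].
  rewrite mem_iota add1n ltnS IH => -[/andP[j0 jN]] /and4P[sz so po le_tj] ->.
  rewrite /= eqSS sz po j0 jN (path_sortedE (rev_trans leq_trans)) so le_tj /=.
  by apply/allP => x /(allP le_tj) /= /leq_trans; apply.
case: m => [//|j t] /=; rewrite (path_sortedE (rev_trans leq_trans)) eqSS.
move=> /and4P[sz /andP[le_tj so] /andP[j0 po] /andP[jN _]].
by exists j, t; rewrite mem_iota add1n ltnS j0 jN IH sz so po le_tj.
Qed.

Lemma star_index_uniq N (k : seq nat) : uniq (star_index N k).
Proof.
elim: k N => [//|k0 k IH] N; apply: allpairs_uniq_dep => //.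
  exact: iota_uniq.
by move=> [j t] [j' t'] _ _ /= [-> ->].
Qed.

Lemma sum_star_index N (k : seq nat) :
  \sum_(m <- star_index N k) \prod_(p <- zip m k) (p.1%:R ^+ p.2)^-1 =
  zstar_trunc R N k.
Proof.
elim: k N => [|k0 k IH] N /=; first by rewrite big_seq1 big_nil.
rewrite big_allpairs_dep -[1%N]addn0 iotaDl big_map -val_enum_ord big_map.
rewrite -big_enum /=; apply: eq_bigr => j _; rewrite add1n -IH mulr_sumr.
by apply: eq_bigr => t _; rewrite /= big_cons.
Qed.

(** The truncations increase, so their limit is their supremum. It equals the supremum over all
    finite index sets because the sets [star_index N k] are cofinal among these. *)
Lemma zstar_trunc_cvg (k : seq nat) :
  (zstar_trunc R N k)%:E @[N --> \oo] --> zeta_star R k.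
Proof.
have := ereal_nondecreasing_cvgn (@zstar_trunc_nd k).
set u := fun N => _; suff -> : zeta_star R k = ereal_sup (range u) by [].
pose a (m : seq nat) : \bar R := (\prod_(p <- zip m k) (p.1%:R ^+ p.2)^-1)%:E.
have a_ge0 m : (0 <= a m)%E.
  by rewrite lee_fin; apply: prodr_ge0 => p _; rewrite invr_ge0 exprn_ge0.
have uE N : u N = (\sum_(m \in [set` star_index N k]) a m)%E.
  by rewrite -fsbig_seq ?star_index_uniq // sumEFin sum_star_index.
apply/eqP; rewrite eq_le; apply/andP; split; last first.
  apply: ge_ereal_sup => _ [N _ <-]; apply: ereal_sup_ubound.
  exists [set` star_index N k] => //; split; first exact: finite_seq.
  by move=> m /=; rewrite mem_star_index => /and4P[/eqP].
apply: ge_ereal_sup => _ [F [finF FS] <-].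
(* N is the largest entry occurring in F, so [star_index N k] contains F. *)
pose N := \max_(m <- finmap.enum_fset (fset_set F)) \max_(i <- m) i.
apply: (@le_trans _ _ (u N)); last by apply: ereal_sup_ubound; exists N.
rewrite uE; apply: lee_fsum_nneg_subset => // [|m|m _];
  [exact: finite_seq| |exact: a_ge0].
rewrite !inE => Fm /=; have [sz so po] := FS m Fm.
rewrite mem_star_index sz eqxx so po /=; apply/allP => i im /=.
apply: leq_trans (@leq_bigmax_seq _ m xpredT id i im isT) _.
apply: (@leq_bigmax_seq _ _ xpredT (fun m : seq nat => \max_(i <- m) i) m) => //.
by rewrite in_fset_set ?inE.
Qed.

End Truncation.

(** * Generating series in h *)

Section Weighted.
Variable R : realType.
Variables xi om : R.
Implicit Types T U : nat -> nat -> R.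

(* In T m n, m counts the letters 2 and n the pairs 3, 1, so that m + 2 n is
   half the weight. *)
Definition weighted T : pser R := fun s =>
  \sum_(n < s.+1)
    if (2 * n <= s)%N then T (s - 2 * n)%N n * (xi ^+ (s - 2 * n) * om ^+ n) else 0.

Lemma eq_weighted T U : (forall m n, T m n = U m n) -> weighted T = weighted U.
Proof.
by move=> eTU; apply/funext => s; apply: eq_bigr => n _; rewrite eTU.
Qed.

Lemma weightedD T U :
  weighted (fun m n => T m n + U m n) = weighted T + weighted U.
Proof.
apply/funext => s; rewrite pserDE /weighted -big_split; apply: eq_bigr => n _ /=.
by case: ifP; rewrite ?addr0 ?mulrDl.
Qed.

Lemma weightedZ c T : weighted (fun m n => c * T m n) = monom c 0 * weighted T.
Proof.
apply/funext => s; rewrite monomM subn0 /weighted mulr_sumr.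
by apply: eq_bigr => n _; case: ifP; rewrite ?mulr0 ?mulrA.
Qed.

Lemma weighted1 :
  weighted (fun m n => ((n == 0%N) && (m == 0%N))%:R) = 1.
Proof.
apply/funext => s; rewrite pser1E /weighted big_ord_recl muln0 subn0 /= big1.
  by case: s => [|s]; rewrite ?mul0r addr0 ?mul1r.
by move=> n _; case: ifP; rewrite ?mul0r.
Qed.

Lemma weighted_shift_two T :
  weighted (fun m n => if m is m'.+1 then T m' n else 0) =
  monom xi 1 * weighted T.
Proof.
apply/funext => -[|s]; rewrite monomM /=.
  by rewrite /weighted big_ord1 mul0r.
rewrite /weighted big_ord_recr /= [X in _ + X]ifF ?addr0; last by apply/negbTE; lia.
rewrite subn1 /= mulr_sumr; apply: eq_bigr => n _.
have [le_ns|lt_sn] := leqP (2 * n) s.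
  by rewrite leqW // subSn //= exprS; ring.
(* Only 2 n = s + 1 remains: no two is left to remove, and the shifted family is 0 there. *)
case: ifP => [le_ns|]; rewrite mulr0 //.
have -> : (s.+1 - 2 * n = 0)%N by lia.
by rewrite mul0r.
Qed.

Lemma weighted_shift_pair T :
  weighted (fun m n => if n is n'.+1 then T m n' else 0) =
  monom om 2 * weighted T.
Proof.
apply/funext => s; rewrite monomM.
rewrite /weighted big_ord_recl /= muln0 subn0 /= mul0r add0r.
case: s => [|[|s]] /=; first by rewrite big_ord0.
  by rewrite big_ord1.
rewrite big_ord_recr /= [X in _ + X]ifF ?addr0; last by apply/negbTE; rewrite /bump; lia.
rewrite subn2 /= mulr_sumr; apply: eq_bigr => n _.
rewrite /bump /= add1n.
have -> : (2 * n.+1 <= s.+2)%N = (2 * n <= s)%N by lia.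
have -> : (s.+2 - 2 * n.+1 = s - 2 * n)%N by lia.
by case: ifP => _; rewrite ?mulr0 // exprS; ring.
Qed.

End Weighted.

(** * The finite identity for words in 3, 1 and twos *)

Section Transfer.
Variable R : realType.

Definition inv_const n : pser R := monom n%:R^-1 0.

Lemma inv_constK n : inv_const n.+1 * n.+1%:R = 1.
Proof. by rewrite -monom_nat monomMM mulVf ?pnatr_eq0 // monom1. Qed.

Lemma inv_constX n k : inv_const n ^+ k = monom (n%:R ^+ k)^-1 0.
Proof.
elim: k => [|k IH]; first by rewrite !expr0 invr1 monom1.
by rewrite exprS IH monomMM exprS invfM.
Qed.

Definition letters31 n : seq nat := flatten (nseq n [:: 3; 1])%N.

Definition star31 N m n : R := twos_sum (letters31 n) m (zstar_trunc R N).
(** What remains of a word once its first 3 is removed. The pair is charged at its 3, so n counts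
    only the complete pairs that follow. *)
Definition star131 N m n : R := twos_sum (1%N :: letters31 n) m (zstar_trunc R N).

(** The level recursions of the two generating series are those of [star_shuffle] with X = x h and Y
    = y h: a two weighs - (X + Y), a pair 4 X Y. *)
Lemma star31_generating (x y a b : R) N :
  a + b = 2 * (x + y) -> a * b = (x - y) ^+ 2 ->
  weighted (- (x + y)) (4 * x * y) (star31 N) *
    (zprod inv_const (monom a 1) N * zprod inv_const (monom b 1) N) =
  \sum_(k < N.+1) (zterm inv_const (monom x 1) * zterm inv_const (monom y 1)) k.
Proof.
move=> sab pab; set xi := - (x + y); set om := 4 * x * y.
have monom_nat1 (m : nat) c : m%:R * monom c 1 = monom (m%:R * c) 1 :> pser R.
  by rewrite -monom_nat monomMM.
have xiE : monom xi 1 = - (monom x 1 + monom y 1) :> pser R.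
  apply/eqP; rewrite -addr_eq0 !monomD; apply/eqP/funext => n.
  by rewrite /monom /xi addNr; case: eqP.
have omE : monom om 2 = 4 * monom x 1 * monom y 1 :> pser R.
  by rewrite monom_nat1 monomMM.
apply: (star_shuffle inv_constK (SA := fun N => weighted xi om (star31 N))
  (SB := fun N => weighted xi om (star131 N))).
- by rewrite !monomD monom_nat1 sab.
- have -> : (monom x 1 - monom y 1) ^+ 2 =
    (monom x 1 + monom y 1) ^+ 2 - 4 * monom x 1 * monom y 1 :> pser R by ring.
  rewrite -omE monomD expr2 !monomMM pab.
  apply/eqP; rewrite eq_sym subr_eq monomD; apply/eqP; congr monom.
  by rewrite /om; ring.
- rewrite -(weighted1 xi om); apply: eq_weighted => m n.
  by rewrite /star31 twos_sum_zstar_trunc0; case: n.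
- apply/funext => s; rewrite /weighted big1 // => n _.
  by rewrite /star131 twos_sum_zstar_trunc0 mul0r; case: ifP.
- move=> M; rewrite -mulNr -omE !inv_constX.
  have rec : weighted xi om (star31 M.+1) =
    weighted xi om (fun m n => star31 M m n
      + (M.+1%:R ^+ 2)^-1 * (if m is m'.+1 then star31 M.+1 m' n else 0)
      + (M.+1%:R ^+ 3)^-1 * (if n is n'.+1 then star131 M.+1 m n' else 0)).
    apply: eq_weighted => m n; rewrite /star31 twos_sum_zstar_truncS.
    by case: n => [|n]; rewrite ?mulr0.
  rewrite [LHS]rec !weightedD !weightedZ weighted_shift_two weighted_shift_pair xiE.
  by ring.
- move=> M; rewrite -mulNr !inv_constX.
  have rec : weighted xi om (star131 M.+1) =
    weighted xi om (fun m n => star131 M m n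
      + (M.+1%:R ^+ 2)^-1 * (if m is m'.+1 then star131 M.+1 m' n else 0)
      + (M.+1%:R ^+ 1)^-1 * star31 M.+1 m n).
    by apply: eq_weighted => m n; rewrite /star131 twos_sum_zstar_truncS.
  rewrite [LHS]rec !weightedD !weightedZ weighted_shift_two xiE expr1.
  by rewrite /inv_const; ring.
Qed.

End Transfer.

(** * Elementary symmetric functions and Vieta's formulas *)

Section ElementarySymmetric.
Variable R : realType.
Implicit Types r : nat -> R.

(** For r k = 1/(k + 1)^2 this is the truncated strict multiple zeta value at a twos. *)
Fixpoint elsym r N a : R :=
  match N, a with
  | _, 0%N => 1
  | 0%N, _ => 0
  | N'.+1, a'.+1 => elsym r N' a + r N' * elsym r N' a'
  end.

Lemma elsym0 r N : elsym r N 0 = 1. Proof. by case: N. Qed.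

Lemma elsym_small r N a : (N < a)%N -> elsym r N a = 0.
Proof.
elim: N a => [|N IH] [|a] //= lt_Na.
by rewrite !IH ?mulr0 ?addr0 // ltnW.
Qed.

Lemma elsym_ge0 r N a : (forall k, 0 <= r k) -> 0 <= elsym r N a.
Proof.
move=> r0; elim: N a => [|N IH] [|a] //=.
by rewrite addr_ge0 ?mulr_ge0.
Qed.

Lemma ler_elsym r r' N a : (forall k, 0 <= r k) ->
  (forall k, (k < N)%N -> r k <= r' k) -> elsym r N a <= elsym r' N a.
Proof.
move=> r0; elim: N a => [|N IH] [|a] //= le_rr'.
have le_rN k : (k < N)%N -> r k <= r' k by move=> lt_kN; apply/le_rr'/ltnW.
by rewrite lerD ?ler_pM ?elsym_ge0 ?IH ?le_rr'.
Qed.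

Lemma elsym_nd r a : (forall k, 0 <= r k) ->
  {homo (elsym r)^~ a : m n / (m <= n)%N >-> m <= n}.
Proof.
move=> r0; apply: homo_leq => [x|y x z|N]; [exact: lexx|exact: le_trans|].
by case: a => [|a]; rewrite ?elsym0 //= lerDl mulr_ge0 ?elsym_ge0.
Qed.

Lemma elsymZ c r N a : elsym (fun k => c * r k) N a = c ^+ a * elsym r N a.
Proof.
elim: N a => [|N IH] [|a] /=; rewrite ?expr0 ?mul1r ?mulr0 //.
by rewrite !IH exprS; ring.
Qed.

Lemma cvg_elsym (rr : nat -> nat -> R) r N a :
  (forall k, rr M k @[M --> \oo] --> r k) ->
  elsym (rr M) N a @[M --> \oo] --> elsym r N a.
Proof.
move=> cr; elim: N a => [|N IH] [|a] /=; [exact: cvg_cst..|].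
by apply: cvgD => //; apply: cvgM.
Qed.

Lemma pser_prod_elsym r N a :
  (\prod_(k < N) (1 + monom (r k) 1) : pser R) a = elsym r N a.
Proof.
elim: N a => [|N IH] a; first by rewrite big_ord0 pser1E; case: a.
rewrite big_ord_recr /= mulrC mulrDl mul1r pserDE monomM !IH.
by case: a => [|a] /=; rewrite ?elsym0 ?addr0 // subn1.
Qed.

Lemma coef_prod_XsubC r N i j : (i + j = N)%N ->
  (\prod_(k < N) ('X - (r k)%:P))`_i = (-1) ^+ j * elsym r N j.
Proof.
elim: N i j => [|N IH] i j.
  by move=> /eqP; rewrite addn_eq0 => /andP[/eqP-> /eqP->];
    rewrite big_ord0 coef1 mul1r.
move=> eij; rewrite big_ord_recr /= mulrBr coefB coefMX coefMC.
have size_p : size (\prod_(k < N) ('X - (r k)%:P)) = N.+1.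
  by rewrite -big_enum /= size_prod_XsubC size_enum_ord.
case: i j eij => [|i] [|j] //= eij.
- rewrite sub0r (IH _ j) //; last by lia.
  have -> : j = N by lia.
  by rewrite (elsym_small r (ltnSn N)) exprS; ring.
- rewrite (IH i 0%N) ?elsym0 //; last by lia.
  by rewrite nth_default ?mul0r ?subr0 // size_p; lia.
- rewrite (IH i j.+1) ?(IH i.+1 j); try by lia.
  by rewrite exprS; ring.
Qed.

(** The N distinct values r k exhaust the roots of a polynomial of degree N with leading coefficient
    2 N + 1, so Vieta's formulas apply. *)
Lemma elsym_of_roots r N a : {in gtn N &, injective r} ->
  (forall k, (k < N)%N ->
    \sum_(j < N.+1) (-1) ^+ j * 'C(N.*2.+1, j.*2.+1)%:R * r k ^+ (N - j) = 0) ->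
  N.*2.+1%:R * elsym r N a = 'C(N.*2.+1, a.*2.+1)%:R.
Proof.
move=> r_inj r_root; have [lt_Na|le_aN] := ltnP N a.
  by rewrite elsym_small // mulr0 bin_small //; lia.
pose p := \poly_(i < N.+1) ((-1) ^+ (N - i) * 'C(N.*2.+1, (N - i).*2.+1)%:R : R).
have pN : p`_N = N.*2.+1%:R by rewrite coef_poly ltnSn subnn mul1r bin1.
have size_p : size p = N.+1.
  by rewrite size_poly_eq // subnn mul1r bin1 pnatr_eq0.
have pE : p = N.*2.+1%:R *: \prod_(k < N) ('X - (r k)%:P).
  rewrite {1}(@all_roots_prod_XsubC _ p (mkseq r N)) ?size_mkseq //.
  - rewrite /lead_coef size_p pN big_map.
    by rewrite -(big_mkord xpredT (fun k => 'X - (r k)%:P)) /index_iota subn0.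
  - apply/allP => _ /mapP[k + ->]; rewrite mem_iota => /= lt_kN.
    rewrite rootE horner_poly (reindex_inj rev_ord_inj) /=; apply/eqP.
    rewrite -[RHS](r_root k) //; apply: eq_bigr => j _.
    by rewrite subSS subKn // -ltnS.
  - rewrite uniq_rootsE map_inj_in_uniq ?iota_uniq // => k l.
    by rewrite !mem_iota; exact: r_inj.
have := congr1 (fun q : {poly R} => q`_(N - a)) pE.
rewrite coefZ (@coef_prod_XsubC _ _ _ a) ?subnK // coef_poly ltnS leq_subr subKn //.
have sign2 : (-1) ^+ a * (-1) ^+ a = 1 :> R by rewrite -exprMn mulrNN mul1r expr1n.
have signK x : (-1) ^+ a * ((-1) ^+ a * x) = x :> R by rewrite mulrA sign2 mul1r.
by move=> coefE; rewrite -[RHS]signK coefE mulrCA signK.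
Qed.

Lemma zprod_elsym (c : R) N a :
  zprod (@inv_const R) (monom c 1) N a =
  c ^+ a * elsym (fun k => (k.+1%:R ^+ 2)^-1) N a.
Proof.
rewrite -elsymZ -pser_prod_elsym /zprod; congr (_ a).
by apply: eq_bigr => k _; rewrite inv_constX monomMM.
Qed.

End ElementarySymmetric.

(** * Squared cotangents as roots of a polynomial *)

Section Cotangent.
Variable R : realType.

(* The binomial expansion of (c + s i)^n, with the powers of i replaced by an
   arbitrary sequence t, which selects the real or the imaginary part. *)
Definition binform (c s : R) n (t : nat -> R) :=
  \sum_(k < n.+1) 'C(n, k)%:R * c ^+ (n - k) * s ^+ k * t k.

Lemma binformS c s n t :
  binform c s n.+1 t = c * binform c s n t + s * binform c s n (t \o S).
Proof.
rewrite /binform big_ord_recl /= bin0 subn0 expr0 mulr1 mul1r.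
under eq_bigr => k _ do rewrite /bump /= add1n subSS binS natrD.
rewrite [X in c * X]big_ord_recl /= bin0 subn0 expr0 mulr1 mul1r.
rewrite mulrDr mulrA -exprS -addrA; congr (_ + _).
transitivity (\sum_(i < n.+1) 'C(n, i.+1)%:R * c ^+ (n - i) * s ^+ i.+1 * t i.+1
  + s * \sum_(i < n.+1) 'C(n, i)%:R * c ^+ (n - i) * s ^+ i * t i.+1).
  rewrite mulr_sumr -big_split /=; apply: eq_bigr => k _; rewrite exprS; ring.
congr (_ + _); rewrite big_ord_recr /= bin_small // !mul0r addr0 mulr_sumr.
apply: eq_bigr => k _; rewrite /bump /= add1n.
have -> : (n - k = (n - k.+1).+1)%N by have := ltn_ord k; lia.
by rewrite exprS; ring.
Qed.

(** The imaginary part of i^k; [cos_sign] is the real part. *)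
Definition sin_sign k : R := if odd k then (-1) ^+ k./2 else 0.
Definition cos_sign k : R := if odd k then 0 else (-1) ^+ k./2.

Lemma sin_cos_binform (x : R) n :
  sin (n%:R * x) = binform (cos x) (sin x) n sin_sign /\
  cos (n%:R * x) = binform (cos x) (sin x) n cos_sign.
Proof.
(* Shifting the index multiplies i^k by i, which exchanges the two parts up to sign. *)
have sinS : sin_sign \o S = cos_sign.
  by apply/funext => k; rewrite /= /sin_sign /cos_sign /= uphalf_half;
    case: (odd k).
have cosS : cos_sign \o S = (fun k => -1 * sin_sign k).
  apply/funext => k; rewrite /= /sin_sign /cos_sign /= uphalf_half.
  by case: (odd k); rewrite ?mulr0 // add1n exprS.
elim: n => [|n [IHs IHc]].
  by rewrite /binform !big_ord1 mul0r sin0 cos0 /sin_sign /cos_sign /= mulr0 !mulr1.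
have -> : n.+1%:R * x = n%:R * x + x by rewrite -addn1 natrD mulrDl mul1r.
rewrite sinD cosD IHs IHc !binformS sinS cosS.
have -> : binform (cos x) (sin x) n (fun k => -1 * sin_sign k) =
  - binform (cos x) (sin x) n sin_sign.
  by rewrite -[RHS]mulN1r /binform mulr_sumr; apply: eq_bigr => k _; ring.
by split; ring.
Qed.

Lemma sum_double n (F : nat -> R) :
  \sum_(k < n.*2) F k = \sum_(j < n) (F j.*2 + F j.*2.+1).
Proof.
elim: n => [|n IH]; first by rewrite !big_ord0.
by rewrite doubleS !big_ord_recr /= IH addrA.
Qed.

(** The imaginary part of de Moivre's formula, in which only odd powers of sin x survive. *)
Lemma sin_odd_cot (x : R) N : sin x != 0 ->
  sin (N.*2.+1%:R * x) = sin x ^+ N.*2.+1 *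
    \sum_(j < N.+1) (-1) ^+ j * 'C(N.*2.+1, j.*2.+1)%:R
                    * ((cos x / sin x) ^+ 2) ^+ (N - j).
Proof.
move=> sx; have [-> _] := sin_cos_binform x N.*2.+1.
rewrite /binform -doubleS (sum_double N.+1 (fun k => 'C(N.*2.+1, k)%:R *
  cos x ^+ (N.*2.+1 - k) * sin x ^+ k * sin_sign k)) mulr_sumr.
apply: eq_bigr => j _; rewrite /sin_sign /= odd_double mulr0 add0r /= uphalf_double.
rewrite -exprM expr_div_n.
have -> : (N.*2.+1 - j.*2.+1 = 2 * (N - j))%N by lia.
have -> : N.*2.+1 = (j.*2.+1 + 2 * (N - j))%N by have := ltn_ord j; lia.
rewrite exprD; have : sin x ^+ (2 * (N - j)) != 0 by rewrite expf_neq0.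
move: (sin x ^+ _) => u u0.
by field.
Qed.

(** By the mean value theorem sin x = x cos c with 0 < c < x, and cos decreases there. *)
Lemma sin_MVT (x : R) : 0 < x < pi / 2 -> x * cos x <= sin x <= x.
Proof.
move=> /andP[x0 xpi].
have [|c] := @MVT R sin cos 0 x x0 (fun y _ => is_derive_sin y).
- exact/continuous_subspaceT/continuous_sin.
rewrite in_itv /= => /andP[c0 cx]; rewrite sin0 !subr0 => ->.
rewrite mulrC ler_pM2r // ger_pMl // cos_le1 andbT.
have pi0 := pi_gt0 R.
apply/ltW; rewrite ltr_cos // in_itv /=; apply/andP; split; lra.
Qed.

(** For k < N these are the zeros of sin ((2 N + 1) x) in (0, pi/2). *)
Definition cot_node N k : R := pi * k.+1%:R / N.*2.+1%:R.

Lemma cot_node_itv N k : (k < N)%N -> 0 < cot_node N k < pi / 2.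
Proof.
move=> lt_kN; have pi0 := pi_gt0 R; rewrite /cot_node.
rewrite divr_gt0 ?mulr_gt0 //= -mulrA ltr_pM2l //.
rewrite ltr_pdivrMr // mulrC ltr_pdivlMr // -natrM ltr_nat; lia.
Qed.

Definition cot2 N k : R := (cos (cot_node N k) / sin (cot_node N k)) ^+ 2.

Lemma sin_pi_nat n : sin (pi * n%:R) = 0 :> R.
Proof.
elim: n => [|n IH]; first by rewrite mulr0 sin0.
by rewrite -addn1 natrD mulrDr mulr1 sinDpi IH oppr0.
Qed.

(** By [sin_odd_cot] the squared cotangents of the nodes are roots of the polynomial in
    [elsym_of_roots]. They are distinct since cot^2 determines cos^2, and cos is positive and
    injective on (0, pi/2). *)
Lemma elsym_cot2 N a :
  N.*2.+1%:R * elsym (cot2 N) N a = 'C(N.*2.+1, a.*2.+1)%:R.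
Proof.
have nodeP k : (k < N)%N -> [/\ 0 < cot_node N k, cot_node N k < pi / 2,
    0 < sin (cot_node N k) & 0 < cos (cot_node N k)].
  move=> /cot_node_itv xk; case/andP: (xk) => x0 xpi; split => //.
    exact: sin_gt0_pihalf.
  by apply: cos_gt0_pihalf; rewrite xpi andbT; have := pi_gt0 R; lra.
apply: elsym_of_roots => [k l|k].
  rewrite !inE => /nodeP[x0 xpi sx cx] /nodeP[y0 ypi sy cy] /eqP.
  rewrite /cot2; set x := cot_node N k in x0 xpi sx cx *.
  set y := cot_node N l in y0 ypi sy cy *.
  have sx0 := expf_neq0 2 (lt0r_neq0 sx); have sy0 := expf_neq0 2 (lt0r_neq0 sy).
  rewrite !expr_div_n eqr_div // !sin2cos2 => /eqP e.
  have {}e : cos x ^+ 2 = cos y ^+ 2.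
    apply/subr0_eq.
    transitivity (cos x ^+ 2 * (1 - cos y ^+ 2) - cos y ^+ 2 * (1 - cos x ^+ 2)).
      by ring.
    by rewrite e subrr.
  have {}e : cos x = cos y by apply/eqP; rewrite -(eqrXn2 (n := 2)) ?ltW // e.
  have pi0 := pi_gt0 R.
  have {}e : x = y.
    by apply: cos_inj e; rewrite in_itv /=; apply/andP; split; lra.
  have : x * N.*2.+1%:R = y * N.*2.+1%:R by rewrite e.
  rewrite /x /y /cot_node !divfK ?pnatr_eq0 // => /(mulfI (lt0r_neq0 pi0)) /eqP.
  by rewrite eqr_nat eqSS => /eqP.
move=> /nodeP[_ _ sx _]; have sx0 : sin (cot_node N k) != 0 by rewrite gt_eqF.
have := sin_odd_cot N sx0; rewrite {1}/cot_node mulrC divfK ?pnatr_eq0 //.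
rewrite sin_pi_nat => /esym/eqP; rewrite mulf_eq0 expf_eq0 (negPf sx0) andbF /=.
by move=> /eqP.
Qed.

End Cotangent.

(** * The limit of the strict sums at repeated twos *)

Section ZetaTwos.
Variable R : realType.

Lemma cvg_invr_odd : (N.*2.+1%:R : R)^-1 @[N --> \oo] --> (0 : R).
Proof.
apply: (@squeeze_cvgr _ _ _ _ (fun=> 0) (@harmonic R)); last exact: cvg_harmonic.
  near=> N; rewrite invr_ge0 ler0n /= lef_pV2 ?posrE ?ltr0n // ler_nat; lia.
exact: cvg_cst.
Unshelve. all: by end_near.
Qed.

(** The falling factorial has b factors, and each divided by 2 N + 1 tends to 1. *)
Lemma cvg_bin_odd b :
  'C(N.*2.+1, b)%:R / N.*2.+1%:R ^+ b @[N --> \oo] --> (b`!%:R : R)^-1.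
Proof.
have -> : (fun N => 'C(N.*2.+1, b)%:R / N.*2.+1%:R ^+ b : R) =
    (fun N => (N.*2.+1 ^_ b)%:R / N.*2.+1%:R ^+ b * (b`!%:R)^-1).
  apply/funext => N; rewrite -bin_ffact natrM.
  by rewrite mulrAC mulfK // pnatr_eq0 -lt0n fact_gt0.
rewrite -[X in _ --> X]mul1r; apply: cvgM; last exact: cvg_cst.
elim: b => [|b IH].
  have -> : (fun N => (N.*2.+1 ^_ 0)%:R / N.*2.+1%:R ^+ 0 : R) = (fun=> 1).
    by apply/funext => N; rewrite ffactn0 expr0 divr1.
  exact: cvg_cst.
have cst (x : R) : (fun=> x) @ \oo --> x by exact: cvg_cst.
have lim1 : (N.*2.+1 ^_ b)%:R / N.*2.+1%:R ^+ b * (1 - b%:R * (N.*2.+1%:R)^-1)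
    @[N --> \oo] --> (1 * (1 - b%:R * 0) : R).
  by apply: cvgM IH _; apply: cvgB (cst 1) _; apply: cvgM (cst b%:R) cvg_invr_odd.
rewrite mulr0 subr0 mulr1 in lim1; apply: cvg_trans lim1; apply: near_eq_cvg.
near=> N.
have le_bM : (b <= N.*2.+1)%N.
  by rewrite (@leq_trans N) //; [near: N; exact: nbhs_infty_ge|lia].
rewrite ffactnSr natrM natrB // exprS.
have M0 : N.*2.+1%:R != 0 :> R by rewrite pnatr_eq0.
have Mb0 : N.*2.+1%:R ^+ b != 0 :> R by rewrite expf_neq0.
move: (N.*2.+1%:R ^+ b) Mb0 => u u0; move: (N.*2.+1%:R) M0 => M M0.
by field; rewrite u0 M0.
Unshelve. all: by end_near.
Qed.

(** With x the node, this is (x cot x)^2 / (k + 1)^2. *)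
Definition scaled_cot2 N k : R := (pi / N.*2.+1%:R) ^+ 2 * cot2 R N k.

Lemma scaled_cot2_bounds N k : (k < N)%N ->
  cos (cot_node R N k) ^+ 2 * (k.+1%:R ^+ 2)^-1 <= scaled_cot2 N k
  <= (k.+1%:R ^+ 2)^-1.
Proof.
move=> lt_kN; have x_itv := cot_node_itv R lt_kN.
have [/andP[x0 xpi] /andP[lo hi]] := (x_itv, sin_MVT x_itv).
have k0 : k.+1%:R != 0 :> R by rewrite pnatr_eq0.
have -> : scaled_cot2 N k =
    (cot_node R N k * cos (cot_node R N k) / sin (cot_node R N k)) ^+ 2
    * (k.+1%:R ^+ 2)^-1.
  rewrite /scaled_cot2 /cot2; move: (cos _) (sin _) => c s; rewrite /cot_node.
  have M0 : N.*2.+1%:R != 0 :> R by rewrite pnatr_eq0.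
  rewrite !(exprMn, exprVn); move: (s ^+ 2)^-1 => S.
  by move: (N.*2.+1%:R) (k.+1%:R) M0 k0 => M K M0 K0; field; rewrite M0 K0.
set x := cot_node R N k in x0 xpi lo hi *.
have s0 : 0 < sin x by apply: sin_gt0_pihalf; rewrite x0.
have c0 : 0 < cos x.
  by apply: cos_gt0_pihalf; rewrite xpi andbT; have := pi_gt0 R; lra.
have q0 : 0 <= x * cos x / sin x.
  by apply: divr_ge0; [apply: mulr_ge0|]; exact: ltW.
have r0 : 0 < (k.+1%:R ^+ 2 : R)^-1 by rewrite invr_gt0 exprn_gt0 ?ltr0n.
apply/andP; split.
  rewrite ler_pM2r // lerXn2r ?nnegrE ?(ltW c0) //.
  by rewrite ler_pdivlMr // [x * _]mulrC ler_pM2l.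
by rewrite ger_pMl // exprn_ile1 // ler_pdivrMr // mul1r.
Qed.

Lemma cvg_scaled_cot2 k : scaled_cot2 N k @[N --> \oo] --> ((k.+1%:R : R) ^+ 2)^-1.
Proof.
apply: (@squeeze_cvgr _ _ _ _
  (fun N => cos (cot_node R N k) ^+ 2 * (k.+1%:R ^+ 2)^-1)
  (fun=> (k.+1%:R ^+ 2)^-1)); last exact: cvg_cst.
  by near=> N; apply: scaled_cot2_bounds; near: N; exact: nbhs_infty_gt.
rewrite -[X in _ --> X]mul1r; apply: cvgM; last exact: cvg_cst.
rewrite -(expr1n R 2) !expr2.
suff cos1 : cos (cot_node R N k) @[N --> \oo] --> (1 : R).
  by under eq_fun do rewrite expr2; apply: cvgM.
rewrite -(@cos0 R); apply: continuous_cvg; first exact: continuous_cos.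
rewrite -(mulr0 (pi * k.+1%:R)); apply: cvgM; first exact: cvg_cst.
exact: cvg_invr_odd.
Unshelve. all: by end_near.
Qed.

(* 1/k^2 is approached from below by rescaled squared cotangents, whose
   elementary symmetric functions are quotients of binomials. *)
Lemma cvg_elsym_inv_sqr a :
  elsym (fun k => ((k.+1%:R : R) ^+ 2)^-1) N a @[N --> \oo] -->
  pi ^+ (2 * a) / ((2 * a).+1)`!%:R.
Proof.
set l := pi ^+ (2 * a) / _.
have s0 N k : 0 <= scaled_cot2 N k by apply: mulr_ge0; exact: sqr_ge0.
have cvg_low : elsym (scaled_cot2 N) N a @[N --> \oo] --> l.
  have -> : (fun N => elsym (scaled_cot2 N) N a) = (fun N =>
      pi ^+ (2 * a) * ('C(N.*2.+1, (2 * a).+1)%:R / N.*2.+1%:R ^+ (2 * a).+1)).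
    apply/funext => N; rewrite elsymZ -exprM.
    have M0 : N.*2.+1%:R != 0 :> R by rewrite pnatr_eq0.
    have : elsym (cot2 R N) N a = 'C(N.*2.+1, (2 * a).+1)%:R / N.*2.+1%:R.
      by rewrite mul2n -elsym_cot2 mulrAC divff // mul1r.
    move=> ->; rewrite expr_div_n exprS.
    have Ma0 : N.*2.+1%:R ^+ (2 * a) != 0 :> R by rewrite expf_neq0.
    move: (N.*2.+1%:R ^+ (2 * a)) Ma0 => u u0; move: (N.*2.+1%:R) M0 => M M0.
    by field; rewrite u0 M0.
  by apply: cvgM; [exact: cvg_cst|exact: cvg_bin_odd].
(* For fixed K the termwise limit in N is dominated by the limit [l] of the full sums, so no
   uniformity in k is required. *)
have up K : elsym (fun k => ((k.+1%:R : R) ^+ 2)^-1) K a <= l.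
  apply: (ler_cvg_to (cvg_elsym (N := K) (a := a) cvg_scaled_cot2) cvg_low).
  near=> N; apply: elsym_nd => //; near: N; exact: nbhs_infty_ge.
apply: (@squeeze_cvgr _ _ _ _ (fun N => elsym (scaled_cot2 N) N a) (fun=> l)) => //.
  near=> N; apply/andP; split; last exact: up.
  by apply: ler_elsym => // k /scaled_cot2_bounds /andP[].
exact: cvg_cst.
Unshelve. all: by end_near.
Qed.

End ZetaTwos.

(** * Limits that are rational multiples of powers of pi *)

Section RationalMultiplesOfPi.
Variable R : realType.

Definition cvg_ratpi d (u : nat -> R) :=
  exists q : rat, u N @[N --> \oo] --> ratr q * pi ^+ d.

Lemma cvg_ratpi_eq d u v : u =1 v -> cvg_ratpi d u -> cvg_ratpi d v.
Proof. by move=> /funext ->. Qed.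

Lemma cvg_ratpi0 d : cvg_ratpi d (fun=> 0).
Proof. by exists 0; rewrite rmorph0 mul0r; exact: cvg_cst. Qed.

Lemma cvg_ratpiD d u v : cvg_ratpi d u -> cvg_ratpi d v ->
  cvg_ratpi d (fun N => u N + v N).
Proof. by move=> [p cu] [q cv]; exists (p + q); rewrite rmorphD mulrDl; exact: cvgD. Qed.

Lemma cvg_ratpi_sum d I (r : seq I) (P : pred I) (u : I -> nat -> R) :
  (forall i, P i -> cvg_ratpi d (u i)) ->
  cvg_ratpi d (fun N => \sum_(i <- r | P i) u i N).
Proof.
move=> cu; elim: r => [|i r IH].
  by apply: cvg_ratpi_eq (cvg_ratpi0 d) => N; rewrite big_nil.
case Pi: (P i); last by apply: cvg_ratpi_eq IH => N; rewrite big_cons Pi.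
by apply: cvg_ratpi_eq (cvg_ratpiD (cu i Pi) IH) => N; rewrite big_cons Pi.
Qed.

Lemma cvg_ratpiM d e u v : cvg_ratpi d u -> cvg_ratpi e v ->
  cvg_ratpi (d + e) (fun N => u N * v N).
Proof.
move=> [p cu] [q cv]; exists (p * q).
by rewrite rmorphM exprD mulrACA; exact: cvgM.
Qed.

Lemma cvg_ratpiZ d (q : rat) u : cvg_ratpi d u ->
  cvg_ratpi d (fun N => ratr q * u N).
Proof.
move=> [p cu]; exists (q * p); rewrite rmorphM -mulrA.
by apply: cvgM => //; exact: cvg_cst.
Qed.

Lemma cvg_ratpiB d u v : cvg_ratpi d u -> cvg_ratpi d v ->
  cvg_ratpi d (fun N => u N - v N).
Proof.
move=> cu /(cvg_ratpiZ (-1)) cv; apply: cvg_ratpi_eq (cvg_ratpiD cu cv) => N.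
by rewrite rmorphN1 mulN1r.
Qed.

Definition cvg_graded (F : nat -> pser R) :=
  forall s, cvg_ratpi (2 * s) (fun N => F N s).

Lemma cvg_gradedM (F G : nat -> pser R) : cvg_graded F -> cvg_graded G ->
  cvg_graded (fun N => F N * G N).
Proof.
move=> cF cG s; apply: cvg_ratpi_sum => i _.
have := cvg_ratpiM (cF i) (cG (s - i)%N).
by rewrite -mulnDr subnKC // -ltnS.
Qed.

(** As G has constant term 1, the coefficient of index s of F is that of H minus products involving
    lower coefficients of F. Strong induction thus yields convergence and rationality together. *)
Lemma cvg_graded_div (F G H : nat -> pser R) : (forall N, G N 0%N = 1) ->
  (forall N, F N * G N = H N) -> cvg_graded G -> cvg_graded H -> cvg_graded F.
Proof.
move=> G0 FG cG cH s; have [n] := ubnP s; elim: n s => // n IH s le_sn.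
have : cvg_ratpi (2 * s) (fun N => H N s - \sum_(i < s) F N i * G N (s - i)%N).
  apply: cvg_ratpiB => //; apply: cvg_ratpi_sum => i _.
  have := cvg_ratpiM (IH i (leq_trans (ltn_ord i) le_sn)) (cG (s - i)%N).
  by rewrite -mulnDr subnKC // ltnW.
apply: cvg_ratpi_eq => N.
by rewrite -FG pserME big_ord_recr /= subnn G0 mulr1 addrAC subrr add0r.
Qed.

Lemma cvg_graded_zprod (c : rat) :
  cvg_graded (zprod (@inv_const R) (monom (ratr c) 1)).
Proof.
move=> s; exists (c ^+ s / ((2 * s).+1)`!%:R).
under eq_fun do rewrite zprod_elsym.
rewrite rmorphM rmorphXn /= fmorphV rmorph_nat -mulrA [_^-1 * _]mulrC.
by apply: cvgM; [exact: cvg_cst|exact: cvg_elsym_inv_sqr].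
Qed.

(** * Partial sums of a product of two series *)

Section ShuffleLimit.
Variables x y : R.
Hypotheses (x0 : 0 <= x) (y0 : 0 <= y).
Local Notation f := (zterm (@inv_const R) (monom x 1)).
Local Notation g := (zterm (@inv_const R) (monom y 1)).
Local Notation zx := (zprod (@inv_const R) (monom x 1)).
Local Notation zy := (zprod (@inv_const R) (monom y 1)).

Lemma zprod_ge0 (c : R) N s : 0 <= c -> 0 <= zprod (@inv_const R) (monom c 1) N s.
Proof.
by move=> c0; rewrite zprod_elsym mulr_ge0 ?exprn_ge0 // elsym_ge0.
Qed.

Lemma zprod_nd (c : R) m n s : 0 <= c -> (m <= n)%N ->
  zprod (@inv_const R) (monom c 1) m s <= zprod (@inv_const R) (monom c 1) n s.
Proof.
move=> c0 le_mn; rewrite !zprod_elsym ler_wpM2l ?exprn_ge0 //.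
exact: elsym_nd.
Qed.

Lemma zterm_ge0 n s : 0 <= f n s.
Proof.
case: n => [|n] /=; first by rewrite pser1E ler0n.
rewrite inv_constX monomMM monomM; case: ifP => // _.
by rewrite mulr_ge0 ?zprod_ge0 // mulr_ge0 // invr_ge0 exprn_ge0.
Qed.

(** Partial summation is multiplication by [tsum], which can be moved onto the second factor. *)
Lemma sum_zterm_conv N :
  \sum_(k < N.+1) (f * g) k = \sum_(i < N.+1) f i * zy (N - i)%N.
Proof.
rewrite -tsumM mulrCA pserME big_ord_recr /= tsumM subnn big_ord0 mulr0 addr0.
apply: eq_bigr => i _; have le_iN : (i <= N)%N by rewrite -ltnS.
by rewrite tsumM subSn // sum_zterm.
Qed.

(** The triangle i + j <= N lies in the square of side N and contains the square of side N/2. All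
    coefficients are nonnegative, so this gives the upper bound here and the lower bound below. *)
Lemma shuffle_sum_le N s :
  (\sum_(k < N.+1) (f * g) k) s <= (zx N * zy N) s.
Proof.
rewrite sum_zterm_conv -(sum_zterm _ _ N) mulr_suml !pser_sumE.
apply: ler_sum => i _; rewrite !pserME; apply: ler_sum => j _.
by rewrite ler_wpM2l ?zterm_ge0 // zprod_nd // leq_subr.
Qed.

Lemma shuffle_sum_ge N s :
  (zx N./2 * zy N./2) s <= (\sum_(k < N.+1) (f * g) k) s.
Proof.
rewrite sum_zterm_conv -(sum_zterm _ _ N./2) mulr_suml !pser_sumE.
have le_hN : (N./2.+1 <= N.+1)%N by lia.
rewrite (big_ord_widen _ (fun i => (f i * zy N./2) s) le_hN) big_mkcond.
apply: ler_sum => i _; rewrite !pserME; case: ifP => lt_ih; last first.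
  by apply: sumr_ge0 => j _; rewrite mulr_ge0 ?zterm_ge0 ?zprod_ge0.
apply: ler_sum => j _; rewrite ler_wpM2l ?zterm_ge0 // zprod_nd //; lia.
Qed.

End ShuffleLimit.

Lemma cvg_half : N./2 @[N --> \oo] --> \oo.
Proof.
by move=> A [K _ KA]; exists K.*2 => // N /= le_KN; apply: KA => /=; lia.
Qed.

Lemma cvg_graded_shuffle (x y : rat) : 0 <= x -> 0 <= y ->
  cvg_graded (fun N => \sum_(k < N.+1)
    (zterm (@inv_const R) (monom (ratr x) 1) *
     zterm (@inv_const R) (monom (ratr y) 1)) k).
Proof.
move=> x0 y0 s.
have [q cq] := cvg_gradedM (cvg_graded_zprod x) (cvg_graded_zprod y) s.
exists q; set z := fun N => _ in cq.
apply: (@squeeze_cvgr _ _ _ _ (fun N => z N./2) z) => //; last first.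
  exact: cvg_comp cvg_half cq.
by near=> N; rewrite /z shuffle_sum_le ?shuffle_sum_ge ?ler0q.
Unshelve. all: by end_near.
Qed.

(** The inverse Vandermonde matrix of distinct rationals is rational, so each c n is a fixed
    rational combination of the given sums. *)
Lemma cvg_ratpi_interpolation d e (t : 'I_d -> rat) (c : 'I_d -> nat -> R) :
  injective t ->
  (forall i, cvg_ratpi e (fun N => \sum_n c n N * ratr (t i) ^+ n)) ->
  forall n, cvg_ratpi e (c n).
Proof.
move=> t_inj ct n; pose V := Vandermonde d (\row_j t j).
have V_unit : V \in unitmx.
  rewrite unitmxE det_Vandermonde unitfE; apply/prodf_neq0 => i _.
  apply/prodf_neq0 => j lt_ij; rewrite !mxE subr_eq0 (inj_eq t_inj).
  by apply: contraTneq lt_ij => ->; rewrite ltnn.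
apply: (@cvg_ratpi_eq _ (fun N => \sum_i ratr (invmx V i n) *
    \sum_m c m N * ratr (t i) ^+ m)); last first.
  by apply: cvg_ratpi_sum => i _; exact: cvg_ratpiZ.
move=> N; under eq_bigr do rewrite mulr_sumr.
rewrite exchange_big /= (bigD1 n) //= [X in _ + X]big1 ?addr0 => [|m ne_mn].
  have := congr1 (fun A : 'M[rat]_d => A n n) (mulmxV V_unit).
  rewrite !mxE eqxx => /(congr1 (ratr : rat -> R)).
  rewrite rmorph_sum rmorph1 /= => e1; rewrite -[RHS]mulr1 -[in RHS]e1 mulr_sumr.
  by apply: eq_bigr => i _; rewrite !mxE rmorphM rmorphXn /=; ring.
have := congr1 (fun A : 'M[rat]_d => A m n) (mulmxV V_unit).
rewrite !mxE (negPf ne_mn) => /(congr1 (ratr : rat -> R)).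
rewrite rmorph_sum rmorph0 /= => e0; rewrite -[RHS](mulr0 (c m N)) -[in RHS]e0 mulr_sumr.
by apply: eq_bigr => i _; rewrite !mxE rmorphM rmorphXn /=; ring.
Qed.

Lemma cvg_ratpi_star31 m n :
  cvg_ratpi (2 * (m + 2 * n)) (fun N => star31 R N m n).
Proof.
set s := (m + 2 * n)%N.
(* These are the values 4 x y for x = 1/(1 + k^2) and y = k^2/(1 + k^2), with k = i + 2. *)
pose t (i : 'I_s.+1) : rat := (2 * i.+2%:R / (1 + i.+2%:R ^+ 2)) ^+ 2.
(* With xi = -1 the twos contribute only a sign; zeros for 2 k > s pad the family to s + 1
   unknowns. *)
pose c (k : 'I_s.+1) N : R :=
  if (2 * k <= s)%N then star31 R N (s - 2 * k) k * (-1) ^+ (s - 2 * k) else 0.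
have lt_ns : (n < s.+1)%N by rewrite /s; lia.
suff cn : cvg_ratpi (2 * s) (c (Ordinal lt_ns)).
  apply: cvg_ratpi_eq (cvg_ratpiZ ((-1) ^+ m) cn) => N.
  rewrite /c /= leq_addl addnK mulrCA rmorphXn rmorphN1 -exprMn mulrNN mul1r.
  by rewrite expr1n mulr1.
have k1 i : 1 + (i.+2%:R : rat) ^+ 2 != 0.
  by rewrite gt_eqF // ltr_pwDl // sqr_ge0.
apply: (@cvg_ratpi_interpolation _ _ t) => [i j|i].
  have t0 l : 0 <= 2 * l.+2%:R / (1 + l.+2%:R ^+ 2) :> rat.
    by rewrite divr_ge0 ?mulr_ge0 // addr_ge0 // sqr_ge0.
  move=> /eqP; rewrite /t eqrXn2 // eqr_div // => /eqP e.
  (* Two parameters give the same value only if they are equal or inverse to each other; integers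
     from 2 on exclude the latter. *)
  have : (i.+2%:R - j.+2%:R) * (i.+2%:R * j.+2%:R - 1) = 0 :> rat.
    apply: (@mulfI _ (-2)) => //; rewrite mulr0.
    transitivity (2 * i.+2%:R * (1 + j.+2%:R ^+ 2) -
                  2 * j.+2%:R * (1 + i.+2%:R ^+ 2) : rat); first by ring.
    by rewrite e subrr.
  move=> /eqP; rewrite mulf_eq0 !subr_eq0 -natrM eqr_nat pnatr_eq1 muln_eq1 orbF.
  by move=> /eqP[] /val_inj.
(* x + y = 1 normalizes xi; since t i = 4 x y is a square, so is the
   discriminant of the quadratic equation for a and b, which are rational. *)
set k : rat := i.+2%:R; have {}k1 : 1 + k ^+ 2 != 0 := k1 i.
pose x := (1 + k ^+ 2)^-1; pose y := k ^+ 2 / (1 + k ^+ 2).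
pose a := (1 + k) ^+ 2 / (1 + k ^+ 2); pose b := (1 - k) ^+ 2 / (1 + k ^+ 2).
have D0 : 0 <= 1 + k ^+ 2 by rewrite addr_ge0 // sqr_ge0.
have x0 : 0 <= x by rewrite invr_ge0.
have y0 : 0 <= y by rewrite divr_ge0 // sqr_ge0.
have sxy : x + y = 1 by rewrite /x /y; field.
have sab : ratr a + ratr b = 2 * (ratr x + ratr y) :> R.
  rewrite -!rmorphD sxy rmorph1 mulr1 -(rmorph_nat (@ratr R)); congr ratr.
  by rewrite /a /b; field.
have pab : ratr a * ratr b = (ratr x - ratr y) ^+ 2 :> R.
  rewrite -rmorphM -rmorphB -rmorphXn; congr ratr.
  by rewrite /a /b /x /y; field.
have graded_star31 : cvg_graded (fun N =>
    weighted (- (ratr x + ratr y)) (4 * ratr x * ratr y) (star31 R N)).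
  apply: cvg_graded_div (fun N => star31_generating N sab pab)
    (cvg_gradedM (cvg_graded_zprod a) (cvg_graded_zprod b))
    (cvg_graded_shuffle x0 y0) => N.
  by rewrite pserME big_ord1 !zprod_elsym !elsym0 !expr0 !mulr1.
apply: cvg_ratpi_eq (graded_star31 s) => N; apply: eq_bigr => l _.
have -> : 4 * ratr x * ratr y = ratr (t i) :> R.
  rewrite -(rmorph_nat (@ratr R)) -!rmorphM; congr ratr.
  by rewrite /t -/k /x /y; field.
rewrite -rmorphD sxy rmorph1 /c; case: ifP => _; last by rewrite mul0r.
by rewrite mulrA.
Qed.

End RationalMultiplesOfPi.

(** * Passage to the zeta-star values *)

Lemma mkseq_letters31 n :
  mkseq (fun i => if odd i then 1 else 3)%N (2 * n) = letters31 n.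
Proof.
elim: n => [//|n IH]; rewrite /letters31 /= -/(letters31 n) -IH.
have -> : (2 * n.+1 = 2 + 2 * n)%N by lia.
rewrite /mkseq iotaD map_cat /=; congr [:: _, _ & _].
rewrite (iotaDl 2 0) -map_comp; apply: eq_map => i /=.
by rewrite negbK.
Qed.

(* The bound a i <= m built into the type of a is implied by the sum condition. *)
Theorem theorem1p1 (R : realType) (m n : nat) :
  exists q : rat,
    (\sum_(a : {ffun 'I_(2 * n).+1 -> 'I_m.+1} | (\sum_i (a i : nat))%N == m)
       zeta_star R (twos_in_31 (fun i => a i : nat)))%E
    = (ratr q * pi ^+ (2 * m + 4 * n))%:E.
Proof.
have [q cq] := cvg_ratpi_star31 R m n; exists q.
have -> : (2 * m + 4 * n = 2 * (m + 2 * n))%N by lia.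
pose P (a : {ffun 'I_(2 * n).+1 -> 'I_m.+1}) := (\sum_i (a i : nat))%N == m.
have cstar : (\sum_(a | P a) (zstar_trunc R N (twos_in_31 (fun i => a i : nat)))%:E)%E
    @[N --> \oo] -->
    (\sum_(a | P a) zeta_star R (twos_in_31 (fun i => a i : nat)))%E.
  apply: cvg_nnesum => a _; last exact: zstar_trunc_cvg.
  by apply: nearW => N; rewrite lee_fin zstar_trunc_ge0.
have : (fun N => (\sum_(a | P a)
    (zstar_trunc R N (twos_in_31 (fun i => a i : nat)))%:E)%E) =
    (fun N => (star31 R N m n)%:E).
  apply/funext => N; rewrite sumEFin; congr EFin.
  rewrite /star31 -mkseq_letters31.
  exact: (@sum_interleave_twos R (2 * n) (fun i => if odd i then 1 else 3)%N m m
    (zstar_trunc R N) (leqnn m)).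
move=> eN; rewrite eN in cstar.
(* Uniqueness of the limit in the extended reals also shows that the sum is finite. *)
apply: (cvg_unique _ cstar); first exact: ereal_hausdorff.
by apply: cvg_EFin; [exact: nearW|exact: cq].
Qed.
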